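(* Let $K\subset\mathbf{R}$ be a compact set of infinite cardinality with $\mathrm{cap}(K)<1$, and let $f:K\to\mathbf{R}$ be a continuous function. Then $f$ is $\mathbf{Z}[T]$-approximable if and only if $f$ is $J(K)$-interpolable.
   Context: For a continuous function $f$ on $K$, $|f|_K=\max_{x\in K}|f(x)|$. For $n\ge 1$, $T_n(K)$ denotes the unique monic real polynomial of degree $n$ that minimizes $|P|_K$ among all monic real polynomials $P$ of degree $n$. The capacity radius of $K$ is $$\mathrm{cap}(K)=\lim_{n\to\infty}|T_n(K)|_K^{1/n}=\lim_{n\to\infty}\ \sup_{x_1,\dots,x_n\in K}\ \prod_{1\leq i\neq j\leq n}|x_i-x_j|^{1/(n(n-1))},$$ the two limits existing and being equal. A function $f:K\to\mathbf{R}$ is $\mathbf{Z}[T]$-approximable if it is a uniform limit on $K$ of polynomials with integer coefficients. For a subset $X\subset K$, $f$ is $X$-interpolable if there exists $R\in\mathbf{Z}[T]$ such that $f=R$ on $X$. Let $B(K)=\{P\in\mathbf{Z}[T] : |P|_K<1\}$ and $J(K)=\{x\in K : P(x)=0 \text{ for all } P\in B(K)\}$. *)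

(* Defs.v *)
(* MathComp-Analysis, over an arbitrary R : realType. *)
From HB Require Import structures.
From mathcomp Require Import all_boot all_order all_algebra.
From mathcomp Require Import all_classical all_reals all_analysis.

Set Implicit Arguments.
Unset Strict Implicit.
Unset Printing Implicit Defensive.

Import Order.TTheory GRing.Theory Num.Theory.
Import numFieldNormedType.Exports.

Local Open Scope classical_set_scope.
Local Open Scope ring_scope.

(* A function on K is represented by a function on R, of which only the values
   on K matter. *)

(* |f|_K.  The supremum is the maximum when K is nonempty and compact and f is
   continuous on K. *)
Definition supnorm (R : realType) (K : set R) (f : R -> R) : R :=
  sup [set `|f x| | x in K].

Definition is_chebyshev (R : realType) (K : set R) (n : nat)
    (P : {poly R}) : Prop :=
  [/\ P \is monic, size P = n.+1 &
      forall Q : {poly R}, Q \is monic -> size Q = n.+1 ->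
        supnorm K (horner P) <= supnorm K (horner Q)].

(* T_n(K).  The default value 0 plays no role when K is compact and infinite:
   the minimizer then exists and is unique. *)
Definition chebyshev_poly (R : realType) (K : set R) (n : nat) : {poly R} :=
  xget 0 [set P : {poly R} | is_chebyshev K n P].

(* The term n = 0, where n%:R^-1 = 0, does not affect the limit. *)
Definition cap (R : realType) (K : set R) : R :=
  limn (fun n : nat => supnorm K (horner (chebyshev_poly K n)) `^ n%:R^-1).

(* The real function defined by a polynomial with integer coefficients. *)
Definition zpoly_fun (R : realType) (P : {poly int}) : R -> R :=
  horner (map_poly intr P).
Arguments zpoly_fun : clear implicits.

Definition ZT_approximable (R : realType) (K : set R) (f : R -> R) : Prop :=
  exists P : nat -> {poly int},
    {uniform K, (fun n : nat => zpoly_fun R (P n)) @ \oo --> f}.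

Definition ZT_interpolable (R : realType) (X : set R) (f : R -> R) : Prop :=
  exists P : {poly int}, forall x : R, X x -> f x = zpoly_fun R P x.

Definition Bset (R : realType) (K : set R) : set {poly int} :=
  [set P : {poly int} | supnorm K (zpoly_fun R P) < 1].

Definition Jset (R : realType) (K : set R) : set R :=
  [set x | K x /\ forall P : {poly int}, Bset K P -> zpoly_fun R P x = 0].

(* Main.v *)
Require Import Defs.
From HB Require Import structures.
From mathcomp Require Import all_boot all_order all_algebra.
From mathcomp Require Import all_classical all_reals all_analysis.
From mathcomp Require Import ring lra.

Import Order.TTheory GRing.Theory Num.Theory.
Import numFieldNormedType.Exports.

Local Open Scope classical_set_scope.
Local Open Scope ring_scope.

Set Implicit Arguments.
Unset Strict Implicit.
Unset Printing Implicit Defensive.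

(** If f is a uniform limit of integer polynomials P_n, then P_n - P_m lies in
    B(K) for all large n and m, so all the late P_n agree on J(K), and f agrees
    with them there.

    Conversely, let f agree on J(K) with an integer polynomial S. If B(K)
    contains only 0, then J(K) = K and f = S on K. Otherwise a nonzero element
    of B(K) has finitely many zeros, and finitely many sums of even powers
    produce U in B(K) whose zeros in K all lie in J(K) (Jset_zero_locus). Two
    facts then combine.
    - Since f - S vanishes where U does, it is within any given distance of
      U^m h for some real polynomial h, for every even m > 0
      (weierstrass_vanishing).
    - There is one constant C such that every real polynomial h is within C, on
      K, of an integer polynomial z (rounding). This is where cap(K) < 1 enters:
      it yields a monic real polynomial q of positive degree with |q|_K < 1
      (cap_lt1_monic), and rounding the q-adic digits of h costs no more than
      a geometric series.
    Thus U^m h is within |U|_K^m C of the integer polynomial U^m z. The exponent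
    m is chosen before h, so that |U|_K^m C is as small as desired, and
    S + U^m z approximates f. *)

(** * Supremum norms of polynomials *)

Lemma infinite_set_nonempty (T : Type) (A : set T) : infinite_set A -> A !=set0.
Proof. by move=> iA; apply/set0P/eqP => A0; apply: iA; rewrite A0. Qed.

Lemma poly_has_ubound (R : realType) (K : set R) (p : {poly R}) :
  compact K -> has_ubound [set `|p.[x]| | x in K].
Proof.
move=> cK.
have : compact (horner p @` K).
  apply: continuous_compact => //.
  by apply: continuous_subspaceT => x; exact: continuous_horner.
move=> /compact_bounded[M [_ MK]].
exists (M + 1) => _ [x Kx <-]; apply: MK; first by rewrite ltrDl.
by exists x.
Qed.

Lemma supnorm_ge (R : realType) (K : set R) (p : {poly R}) (x : R) :
  compact K -> K x -> `|p.[x]| <= supnorm K (horner p).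
Proof.
move=> cK Kx; apply: ub_le_sup; first exact: poly_has_ubound.
by exists x.
Qed.

Lemma supnorm_le (R : realType) (K : set R) (f : R -> R) (c : R) :
  K !=set0 -> (forall x, K x -> `|f x| <= c) -> supnorm K f <= c.
Proof.
move=> [x Kx] fc; apply: ge_sup; first by exists `|f x|, x.
by move=> _ [y Ky <-]; exact: fc.
Qed.

Lemma supnorm_ge0 (R : realType) (K : set R) (p : {poly R}) :
  compact K -> K !=set0 -> 0 <= supnorm K (horner p).
Proof.
by move=> cK [x Kx]; apply: le_trans (supnorm_ge p cK Kx); exact: normr_ge0.
Qed.

Lemma supnormM (R : realType) (K : set R) (p q : {poly R}) :
  compact K -> K !=set0 ->
  supnorm K (horner (p * q)) <= supnorm K (horner p) * supnorm K (horner q).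
Proof.
move=> cK K0; apply: supnorm_le => // x Kx.
by rewrite hornerM normrM ler_pM// supnorm_ge.
Qed.

Lemma supnorm_lerD (R : realType) (K : set R) (p q : {poly R}) :
  compact K -> K !=set0 ->
  supnorm K (horner p) <= supnorm K (horner q) + supnorm K (horner (p - q)).
Proof.
move=> cK K0; apply: supnorm_le => // x Kx.
rewrite -[p in leLHS](subrK q) addrC hornerD (le_trans (ler_normD _ _))//.
by rewrite lerD// supnorm_ge.
Qed.

Lemma supnorm1 (R : realType) (K : set R) :
  K !=set0 -> supnorm K (horner (1 : {poly R})) = 1.
Proof.
move=> K0; apply/eqP; rewrite eq_le supnorm_le//=; last first.
  by move=> x _; rewrite hornerC normr1.
case: K0 => x Kx; apply: ub_le_sup; last first.
  by exists x => //; rewrite hornerC normr1.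
by exists 1 => _ [y _ <-]; rewrite hornerC normr1.
Qed.

(** * Chebyshev polynomials *)

Lemma infinite_set_injection (R : realType) (K : set R) :
  infinite_set K -> exists2 x : nat -> R, injective x & forall i, K (x i).
Proof.
move=> /infiniteP/pcard_leP/injfunPex[x xK xI]; exists x => [i j|i].
  by apply: xI; rewrite inE.
exact: xK.
Qed.

(** The lower-order part of a monic polynomial of degree n+1 is determined by its
    values at n+1 points of K. In these coordinates the candidates that do at
    least as well as X^(n+1) fill part of a box, since a norm bounds the values
    at the sample points; the norm is Lipschitz on this compact box. *)
Lemma chebyshev_exists (R : realType) (K : set R) (n : nat) :
  compact K -> infinite_set K -> exists P, is_chebyshev K n P.
Proof.
move=> cK infK; have K0 := infinite_set_nonempty infK.
case: n => [|n].
  exists 1; split; [exact: monic1|exact: size_poly1|move=> Q mQ sQ].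
  suff -> : Q = 1 by [].
  move: mQ; rewrite (size1_polyC (eq_leq sQ)) monicE lead_coefC => /eqP ->.
  by [].
have [x xI Kx] := infinite_set_injection infK.
pose l : 'I_n.+1 -> {poly R} := fun i => val (tnth (lagrange n.+1 x) i).
pose q (u : 'rV[R]_n.+1) : {poly R} := \sum_i u ord0 i *: l i.
pose F u := supnorm K (horner ('X^(n.+1) - q u)).
have qx u (i : 'I_n.+1) : (q u).[x i] = u ord0 i.
  rewrite horner_sum (bigD1 i)//= big1 ?addr0 => [|j ji].
    by rewrite hornerZ lagrange_sample// eqxx mulr1.
  by rewrite hornerZ lagrange_sample// (negbTE ji) mulr0.
have qE (p : {poly R}) : (size p <= n.+1)%N -> p = q (\row_(i < n.+1) p.[x i]).
  move=> sp; rewrite [LHS](lagrange_gen (ltn0Sn n) xI sp).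
  by apply: eq_bigr => i _; rewrite mxE mul_polyC.
have sq u : (size (q u) <= n.+1)%N.
  apply: (leq_trans (size_sum _ _ _)); apply/bigmax_leqP => i _.
  by rewrite (leq_trans (size_scale_leq _ _))// size_lagrange_.
have mXq u : ('X^(n.+1) - q u : {poly R}) \is monic /\
    size ('X^(n.+1) - q u : {poly R}) = n.+2.
  have lt_size : (size (- q u) < size ('X^(n.+1) : {poly R}))%N.
    by rewrite size_polyN size_polyXn ltnS.
  split; last by rewrite size_polyDl// size_polyXn.
  by rewrite monicE lead_coefDl// lead_coefXn.
(* The box is centred at the values of X^(n+1), the case q = 0. *)
pose box := [set v : 'rV[R]_n.+1 | forall i : 'I_n.+1,
  `[x i ^+ n.+1 - F 0, x i ^+ n.+1 + F 0]%classic (v ord0 i)].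
have cbox : compact box.
  apply: (@rV_compact R n.+1
    (fun i : 'I_n.+1 => `[x i ^+ n.+1 - F 0, x i ^+ n.+1 + F 0]%classic)) => i.
  exact: segment_compact.
have boxP u : F u <= F 0 -> box u.
  move=> Fu i /=; rewrite in_itv/=.
  suff : `|x i ^+ n.+1 - u ord0 i| <= F 0.
    by rewrite ler_norml => /andP[? ?]; apply/andP; split; lra.
  apply: le_trans Fu; rewrite -(qx u i) -hornerXn -hornerN -hornerD.
  exact: supnorm_ge.
pose C := \sum_i supnorm K (horner (l i)).
have C0 : 0 <= C by apply: sumr_ge0 => i _; exact: supnorm_ge0.
have Flip (u v : 'rV[R]_n.+1) e : (forall i : 'I_n.+1, `|u ord0 i - v ord0 i| <= e) ->
    F u <= F v + e * C.
  move=> uve; apply: le_trans (supnorm_lerD _ ('X^(n.+1) - q v) cK K0) _.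
  rewrite lerD2l; apply: supnorm_le => // y Ky.
  rewrite (_ : _ - _ = \sum_i (v ord0 i - u ord0 i) *: l i); last first.
    rewrite opprB addrC addrA subrK -sumrB.
    by apply: eq_bigr => i _; rewrite scalerBl.
  rewrite horner_sum mulr_sumr (le_trans (ler_norm_sum _ _ _))// ler_sum// => i _.
  rewrite hornerZ normrM ler_pM//; last exact: supnorm_ge.
  by rewrite distrC.
have cF : continuous F.
  move=> u; apply: (iffRL (@cvgrPdist_le _ _ _ _ (nbhs_filter u) F (F u))).
  move=> e e0.
  have d0 : 0 < e / (C + 1) by rewrite divr_gt0// ltr_wpDl.
  apply/nbhs_ballP; exists (e / (C + 1)) => // v [_ uv].
  have uv' (i : 'I_n.+1) : `|u ord0 i - v ord0 i| <= e / (C + 1) by exact/ltW/uv.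
  have vu' (i : 'I_n.+1) : `|v ord0 i - u ord0 i| <= e / (C + 1) by rewrite distrC.
  have := Flip _ _ _ uv'; have := Flip _ _ _ vu'.
  have : e / (C + 1) * C <= e.
    by rewrite mulrAC ler_pdivrMr ?ltr_wpDl// mulrDr mulr1 lerDl ltW.
  by move=> ? ? ?; rewrite ler_norml; apply/andP; split; lra.
have box0 : box 0 by exact: boxP.
have [|u _ umin] := @compact_EVT_min _ R F box (ex_intro _ _ box0) cbox.
  exact: (continuous_subspaceT cF).
have [mu su] := mXq u.
exists ('X^(n.+1) - q u); split=> // Q mQ sQ.
have [v ->] : exists v, Q = 'X^(n.+1) - q v.
  exists (\row_(i < n.+1) ('X^(n.+1) - Q).[x i]); rewrite -qE ?opprB ?subrKC//.
  apply/leq_sizeP => j; rewrite leq_eqVlt coefB coefXn => /predU1P[<-|nj].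
    by move: mQ; rewrite eqxx monicE /lead_coef sQ => /eqP ->; rewrite subrr.
  by rewrite gtn_eqF// nth_default ?subrr// sQ.
have [Fv|/ltW Fv] := leP (F v) (F 0).
  by apply: umin; rewrite inE; exact: boxP.
by apply: le_trans Fv; apply: umin; rewrite inE.
Qed.

Lemma chebyshev_polyP (R : realType) (K : set R) (n : nat) :
  compact K -> infinite_set K -> is_chebyshev K n (chebyshev_poly K n).
Proof.
move=> cK infK; have [P PK] := chebyshev_exists n cK infK.
exact: (xgetPex 0 (ex_intro _ _ PK)).
Qed.

Lemma supnorm_chebyshev_add (R : realType) (K : set R) (m n : nat) :
  compact K -> infinite_set K ->
  supnorm K (horner (chebyshev_poly K (m + n))) <=
  supnorm K (horner (chebyshev_poly K m)) *
  supnorm K (horner (chebyshev_poly K n)).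
Proof.
move=> cK infK; have [_ _ minT] := chebyshev_polyP (m + n) cK infK.
have [mm sm _] := chebyshev_polyP m cK infK.
have [mn sn _] := chebyshev_polyP n cK infK.
apply: le_trans (supnormM _ _ cK (infinite_set_nonempty infK)).
apply: minT; first by rewrite monicMl.
by rewrite size_monicM ?monic_neq0// sm sn addSn addnS.
Qed.

(** * Subadditive sequences *)

(** Write n = k m + i with i < m: then b n <= k b m + b i, and B absorbs all the
    remainders b i. *)
Lemma subadditive_div_le (R : realType) (b : nat -> R) (m : nat) :
  (0 < m)%N -> (forall n, 0 <= b n) ->
  (forall i j, b (i + j)%N <= b i + b j) ->
  exists B, forall n, b n <= n%:R * (b m / m%:R) + B.
Proof.
move=> m0 b0 bD; exists (\sum_(i < m) b i) => n.
have bM k r : b (k * m + r)%N <= k%:R * b m + b r.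
  elim: k => [|k IH]; first by rewrite mul0n mul0r add0r.
  rewrite mulSn -addnA (le_trans (bD _ _))// -natr1 mulrDl mul1r.
  by rewrite -addrA [leRHS]addrCA lerD2l.
rewrite {1}(divn_eq n m) (le_trans (bM _ _))// lerD//.
  rewrite mulrA ler_pdivlMr ?ltr0n// mulrAC ler_wpM2r// -natrM ler_nat.
  exact: leq_trunc_div.
by rewrite (bigD1 (Ordinal (ltn_pmod n m0)))//= lerDl sumr_ge0.
Qed.

(** The limit is the infimum of b n / n over n > 0. *)
Lemma fekete (R : realType) (b : nat -> R) :
  (forall n, 0 <= b n) -> (forall i j, b (i + j)%N <= b i + b j) ->
  cvgn (fun n => b n / n%:R).
Proof.
move=> b0 bD.
pose S := [set b n / n%:R | n in [set n | (0 < n)%N]].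
have lS : has_inf S.
  split; first by exists (b 1%N / 1), 1%N.
  by exists 0 => _ [n n0 <-]; rewrite divr_ge0.
apply/cvg_ex; exists (inf S); apply/cvgrPdist_le => e e0.
have e20 : 0 < e / 2 by lra.
have [_ [m m0 <-] mS] := inf_adherent e20 lS.
have [B bB] := subadditive_div_le m0 b0 bD.
near=> n.
have n0 : (0 < n)%N by near: n; exists 1%N.
have n0' : 0 < n%:R :> R by rewrite ltr0n.
have Sn : inf S <= b n / n%:R by apply: (ge_inf lS.2); exists n.
have : b n / n%:R <= b m / m%:R + B / n%:R.
  by rewrite ler_pdivrMr// mulrDl divfK ?gt_eqF// mulrC.
have : B / n%:R <= e / 2.
  rewrite ler_pdivrMr// mulrC -ler_pdivrMr//.
  by near: n; exact: nbhs_infty_ger.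
by move=> ? ?; rewrite distrC ger0_norm ?subr_ge0//; lra.
Unshelve. all: by end_near. Qed.

(** If no such polynomial existed, all the Chebyshev norms would be at least 1.
    Their logarithms form a nonnegative subadditive sequence, so the limit that
    defines the capacity exists, and it is then at least 1. The existence of the
    limit cannot be skipped: the limit of a divergent sequence is a default
    value, on which a lower bound for the terms says nothing. *)
Lemma cap_lt1_monic (R : realType) (K : set R) :
  compact K -> infinite_set K -> cap K < 1 ->
  exists q : {poly R},
    [/\ q \is monic, (1 < size q)%N & supnorm K (horner q) < 1].
Proof.
move=> cK infK capK; apply: contrapT => noq.
pose a n := supnorm K (horner (chebyshev_poly K n)).
have a1 n : (0 < n)%N -> 1 <= a n.
  move=> n0; rewrite leNgt; apply/negP => an; apply: noq.
  have [mT sT _] := chebyshev_polyP n cK infK.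
  by exists (chebyshev_poly K n); rewrite sT.
have {}a1 n : 1 <= a n.
  case: n => [|n]; last exact: a1.
  rewrite -(supnorm1 (infinite_set_nonempty infK)).
  have [mT sT _] := chebyshev_polyP 0 cK infK.
  rewrite /a; suff -> : chebyshev_poly K 0 = 1 by [].
  move: mT; rewrite (size1_polyC (eq_leq sT)) monicE lead_coefC => /eqP ->.
  by [].
have a0 n : 0 < a n by exact: lt_le_trans (a1 n).
have aE n : a n `^ n%:R^-1 = expR (ln (a n) / n%:R).
  by rewrite /powR gt_eqF// mulrC.
have : cvgn (fun n => ln (a n) / n%:R).
  apply: fekete => [n|m n]; first exact: ln_ge0.
  rewrite -lnM ?posrE// ler_ln ?posrE ?mulr_gt0//.
  exact: supnorm_chebyshev_add.
move=> /cvg_ex[l lnl].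
have capl : (fun n => a n `^ n%:R^-1) @ \oo --> expR l.
  by rewrite (funext aE); apply: continuous_cvg lnl; exact: continuous_expR.
move: capK; rewrite ltNge => /negP; apply.
apply: limr_ge; first by apply/cvg_ex; exists (expR l).
by near=> n; rewrite -/(a n) aE -expR0 ler_expR divr_ge0// ln_ge0.
Unshelve. all: by end_near. Qed.

(** * Rounding polynomials to integer coefficients *)

Lemma sum_expr_divn_le (R : realType) (r : R) (n m : nat) :
  (0 < n)%N -> 0 <= r < 1 ->
  \sum_(0 <= d < m) r ^+ (d %/ n) <= n%:R / (1 - r).
Proof.
move=> n0 /andP[r0 r1].
apply: (@le_trans _ _ (\sum_(0 <= d < m * n) r ^+ (d %/ n))).
  rewrite (@big_cat_nat _ _ _ m 0 (m * n)) ?leq_pmulr//= lerDl sumr_ge0// => i _.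
  exact: exprn_ge0.
have block i : \sum_(i * n <= d < i.+1 * n) r ^+ (d %/ n) = n%:R * r ^+ i.
  rewrite (eq_big_nat _ _ (F2 := fun=> r ^+ i)) => [|d /andP[id di]].
    by rewrite sumr_const_nat mulSn addnK mulr_natl.
  by congr (_ ^+ _); apply/eqP; rewrite eqn_leq -ltnS ltn_divLR// di leq_divRL.
rewrite big_nat_mul (eq_bigr _ (fun i _ => block i)) -mulr_sumr ler_wpM2l//.
rewrite big_mkord -[leRHS]mul1r ler_pdivlMr ?subr_gt0//.
have := subrX1 r m; have := exprn_ge0 m r0; rewrite mulrC.
by move: (r ^+ m) (\sum_(i < m) _) => u v; lra.
Qed.

(** The polynomials e_d = X^(d mod n) q^(d div n), where n is the degree of q, are
    monic of degree d, and their norms on K are summable. From the top degree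
    down, subtracting from h a multiple of e_d with factor in [0, 1) makes the
    coefficient of X^d an integer; C bounds the sum of all these corrections. *)
Lemma rounding (R : realType) (K : set R) (q : {poly R}) :
  compact K -> q \is monic -> (1 < size q)%N -> supnorm K (horner q) < 1 ->
  exists C, forall h : {poly R}, exists z : {poly int},
    forall x, K x -> `|h.[x] - zpoly_fun R z x| <= C.
Proof.
move=> cK mq sq q1.
have [K0|/set0P K0] := eqVneq K set0.
  by exists 0 => h; exists 0 => x; rewrite K0.
set r := supnorm K (horner q) in q1.
have r0 : 0 <= r by exact: supnorm_ge0.
pose n := (size q).-1.
have n0 : (0 < n)%N by rewrite /n; case: (size q) sq => [|[]].
have [M MK] : exists M, forall x, K x -> `|x| <= M.
  have [M MK] := poly_has_ubound 'X cK.
  by exists M => x Kx; apply: MK; exists x; rewrite ?hornerX.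
pose A := Num.max 1 M ^+ n.
have A1 x d : K x -> (d <= n)%N -> `|x| ^+ d <= A.
  move=> Kx dn; apply: (@le_trans _ _ (Num.max 1 M ^+ d)).
    by rewrite lerXn2r ?nnegrE ?le_max ?ler01 ?MK ?orbT.
  by rewrite ler_weXn2l ?le_max ?lexx.
pose e d := 'X^(d %% n) * q ^+ (d %/ n).
have me d : e d \is monic by rewrite rpredM ?monicXn ?rpredX.
have se d : size (e d) = d.+1.
  rewrite size_monicM ?monicXn ?monic_neq0 ?rpredX// size_polyXn addSn/=.
  have := size_exp q (d %/ n); rewrite -/n.
  have : (0 < size (q ^+ (d %/ n)))%N by rewrite size_poly_gt0 monic_neq0 ?rpredX.
  case: (size (q ^+ _)) => // s _ /= ->.
  by rewrite addnS mulnC addnC -divn_eq.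
have be d x : K x -> `|(e d).[x]| <= A * r ^+ (d %/ n).
  move=> Kx; rewrite hornerM hornerXn horner_exp normrM !normrX.
  rewrite ler_pM ?exprn_ge0//; first by rewrite A1// ltnW// ltn_pmod.
  by rewrite lerXn2r ?nnegrE// supnorm_ge.
exists (A * (n%:R / (1 - r))) => h.
have [z zh] : exists z : {poly int}, forall x, K x ->
    `|h.[x] - zpoly_fun R z x| <= \sum_(0 <= d < size h) A * r ^+ (d %/ n).
  suff H D : forall p : {poly R}, (size p <= D)%N -> exists z : {poly int},
      forall x, K x ->
      `|p.[x] - zpoly_fun R z x| <= \sum_(0 <= d < D) A * r ^+ (d %/ n).
    exact: H.
  elim: D => [p|D IH p sp].
    rewrite leqn0 size_poly_eq0 => /eqP ->; exists 0 => x Kx.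
    by rewrite /zpoly_fun rmorph0 !horner0 subr0 normr0 big_nil.
  pose c := p`_D; pose k := Num.floor c.
  have [|z zp] := IH (p - (c - k%:~R) *: e D - k%:~R *: 'X^D).
    apply/leq_sizeP => j; rewrite leq_eqVlt => /predU1P[<-|Dj].
      rewrite !coefB !coefZ coefXn eqxx mulr1.
      have /eqP := me D; rewrite /lead_coef se/= => ->.
      by rewrite mulr1 -/c; ring.
    rewrite !coefB !coefZ coefXn gtn_eqF// mulr0 subr0.
    by rewrite nth_default ?(leq_trans sp)// nth_default ?se// mulr0 subr0.
  exists (z + k *: 'X^D) => x Kx.
  have -> : p.[x] - zpoly_fun R (z + k *: 'X^D) x =
      (p - (c - k%:~R) *: e D - k%:~R *: 'X^D).[x] - zpoly_fun R z x +
      (c - k%:~R) * (e D).[x].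
    rewrite /zpoly_fun rmorphD/= map_polyZ/= map_polyXn !hornerE.
    by ring.
  rewrite big_nat_recr//= (le_trans (ler_normD _ _))// lerD ?zp//.
  rewrite normrM (le_trans _ (be D x Kx))// ler_piMl//.
  have /andP[kc ck] := floor_itv c.
  by rewrite ger0_norm ?subr_ge0//; rewrite intrD in ck; rewrite /k; lra.
exists z => x Kx; apply: le_trans (zh x Kx) _.
rewrite -mulr_sumr ler_wpM2l// ?sum_expr_divn_le ?r0//.
by rewrite exprn_ge0// le_max ler01.
Qed.

(** * Polynomial approximation of continuous functions *)

(** The expectation of phi(S), where S counts the successes in n independent
    trials of probability 'X. Conditioning on one trial gives the recursion, which
    avoids binomial coefficients. *)
Fixpoint bernstein (R : nzRingType) (n : nat) (phi : nat -> R) : {poly R} :=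
  if n is m.+1 then
    'X * bernstein m (fun k => phi k.+1) + (1 - 'X) * bernstein m phi
  else (phi 0%N)%:P.

(** The quadratic on the right is the second moment about c of the number of
    successes: squared bias plus variance. *)
Lemma bernstein_dist_le (R : realFieldType) (n : nat) (phi : nat -> R)
    (a c e C t : R) :
  0 <= t <= 1 -> (forall k, `|phi k - a| <= e + C * (k%:R - c) ^+ 2) ->
  `|(bernstein n phi).[t] - a| <=
  e + C * ((n%:R * t - c) ^+ 2 + n%:R * (t * (1 - t))).
Proof.
move=> /andP[t0 t1]; elim: n phi c => [|n IH] phi c phiP /=.
  by rewrite hornerC !mul0r addr0.
set p := bernstein n _; set q := bernstein n _.
have -> : ('X * p + (1 - 'X) * q).[t] - a =
    t * (p.[t] - a) + (1 - t) * (q.[t] - a) by rewrite !hornerE; ring.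
apply: le_trans (ler_normD _ _) _; rewrite !normrM (ger0_norm t0).
have t1' : 0 <= 1 - t by rewrite subr_ge0.
rewrite (ger0_norm t1').
have := ler_wpM2l t1' (IH _ _ phiP).
have phiSP k : `|phi k.+1 - a| <= e + C * (k%:R - (c - 1)) ^+ 2.
  by have := phiP k.+1; rewrite -natr1 opprB addrA addrAC.
have := ler_wpM2l t0 (IH _ _ phiSP).
rewrite -natr1; move: (n%:R) => N h1 h2.
apply: le_trans (lerD h1 h2) _.
by rewrite le_eqVlt; apply/orP; left; apply/eqP; ring.
Qed.

(** For y near x continuity makes the difference at most e; for y away from x,
    the bound 2B on the difference is absorbed by C (y - x)^2 with C large. Compactness
    makes C uniform in x. *)
Lemma quadratic_modulus (R : realType) (K : set R) (g : R -> R) (B e : R) :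
  compact K -> continuous g -> (forall x, `|g x| <= B) -> 0 < e ->
  exists2 C, 0 <= C &
    forall x y, K x -> `|g y - g x| <= e + C * (y - x) ^+ 2.
Proof.
move=> cK cg gB e0.
have B0 : 0 <= B := le_trans (normr_ge0 _) (gB 0).
have : \forall C \near +oo,
    K `<=` [set x | forall y, `|g y - g x| <= e + C * (y - x) ^+ 2].
  apply: (compact_near_coveringP _).1 cK _ _ (fun C x =>
    forall y, `|g y - g x| <= e + C * (y - x) ^+ 2) _ _ => x Kx.
  have /cvgrPdist_lt /(_ (e / 2)) := cg x.
  case=> [|d /= d0 dP]; first by rewrite divr_gt0.
  have d20 : 0 < d / 2 by rewrite divr_gt0.
  exists (ball x (d / 2), [set C | (2 * B) / (d / 2) ^+ 2 < C]).
    split=> /=; first exact: nbhsx_ballx.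
    by exists ((2 * B) / (d / 2) ^+ 2); split; first exact: num_real.
  move=> [z C] /= [xz CB] y; have {}xz : `|x - z| < d / 2 := xz.
  have C0 : 0 < C.
    by apply: le_lt_trans CB; rewrite divr_ge0 ?mulr_ge0 ?exprn_ge0// ltW.
  have [yz|yz] := ltP `|y - z| (d / 2).
    have gz : `|g x - g z| < e / 2 by apply: dP => /=; lra.
    have gy : `|g x - g y| < e / 2.
      apply: dP => /=; have := ler_distD z x y.
      by rewrite (distrC z y); lra.
    have := ler_distD (g x) (g y) (g z); rewrite (distrC (g y) (g x)) => h.
    have : 0 <= C * (y - z) ^+ 2 by rewrite mulr_ge0 ?sqr_ge0// ltW.
    lra.
  have h1 : `|g y - g z| <= 2 * B.
    by rewrite (le_trans (ler_normB _ _))// mulr2n mulrDl mul1r lerD.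
  have h2 : (d / 2) ^+ 2 <= (y - z) ^+ 2.
    by rewrite -[leRHS]real_normK ?num_real// lerXn2r ?nnegrE// ltW.
  have h3 : 2 * B <= C * (d / 2) ^+ 2.
    by move: CB; rewrite ltr_pdivrMr ?exprn_gt0// => /ltW.
  have := ler_wpM2l (ltW C0) h2; lra.
move=> nearC.
have [C [C0 KC]] := filter_ex (filterI (nbhs_pinfty_ge (num_real 0)) nearC).
by exists C => // x y Kx; exact: KC.
Qed.

(** Bernstein's proof, applied to a bounded continuous extension of f to the whole
    line, rescaled so that K lies over [0, 1]. *)
Lemma weierstrass (R : realType) (K : set R) (f : R -> R) (e : R) :
  compact K -> {within K, continuous f} -> 0 < e ->
  exists h : {poly R}, forall x, K x -> `|f x - h.[x]| <= e.
Proof.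
move=> cK cf e0.
have clK : closed K by apply: compact_closed => //; exact: Rhausdorff.
have [B [_ fB]] := compact_bounded (continuous_compact cf cK).
have fB' x : K x -> `|f x| <= `|B| + 1.
  by move=> Kx; apply: fB; [rewrite ltr_pwDr// ler_norm|exists x].
have [|g [fg cg gB]] :=
  continuous_bounded_extension (@pseudometric_normal R R) clK _ cf fB'.
  by rewrite ltr_wpDl.
have e20 : 0 < e / 2 by rewrite divr_gt0.
have [C C0 gC] := quadratic_modulus cK cg gB e20.
have [M0 [_ KM]] := compact_bounded cK.
pose M := `|M0| + 1.
have M0' : 0 < M by rewrite ltr_wpDl.
have KM' x : K x -> - M <= x <= M.
  by move=> Kx; rewrite -ler_norml; apply: KM => //; rewrite ltr_pwDr// ler_norm.
near \oo => n.
have n0 : 0 < n%:R :> R by rewrite ltr0n; near: n; exists 1%N.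
pose phi k := g (2 * M * (k%:R / n%:R) - M).
pose u := (2 * M)^-1 *: ('X + M%:P).
exists (bernstein n phi \Po u) => x Kx.
have /andP[Mx xM] := KM' x Kx.
rewrite horner_comp; set t := u.[x].
have tE : t = (x + M) / (2 * M) by rewrite /t /u !hornerE mulrC.
have xE : x = 2 * M * t - M by rewrite tE; field; lra.
have t01 : 0 <= t <= 1.
  rewrite tE divr_ge0/= ?ler_pdivrMr; lra.
have phiP k : `|phi k - g x| <=
    e / 2 + C * (2 * M / n%:R) ^+ 2 * (k%:R - n%:R * t) ^+ 2.
  apply: le_trans (gC x _ Kx) _; rewrite lerD2l -[leRHS]mulrA ler_wpM2l//.
  rewrite -exprMn {1}xE le_eqVlt; apply/orP; left; apply/eqP.
  by congr (_ ^+ 2); field; lra.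
rewrite distrC fg ?inE//; apply: le_trans (bernstein_dist_le n t01 phiP) _.
rewrite subrr expr0n add0r.
have : C * (2 * M / n%:R) ^+ 2 * (n%:R * (t * (1 - t))) <=
    C * (2 * M) ^+ 2 / n%:R.
  have -> : C * (2 * M / n%:R) ^+ 2 * (n%:R * (t * (1 - t))) =
    (C * (2 * M) ^+ 2 / n%:R) * (t * (1 - t)) by field; lra.
  rewrite ler_piMr ?divr_ge0 ?mulr_ge0 ?sqr_ge0// ?ltW//.
  case/andP: t01; nra.
have : C * (2 * M) ^+ 2 / n%:R <= e / 2.
  rewrite ler_pdivrMr// [leRHS]mulrC -ler_pdivrMr//.
  by near: n; exact: nbhs_infty_ger.
lra.
Unshelve. all: by end_near. Qed.

(** The quotient f / v is not defined at the zeros of v, so f / (v + psi) is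
    approximated in its place, where psi = max (e/2 - |f|, 0). As f vanishes with v, the
    denominator is positive on K. The error f psi / (v + psi) is at most e/2,
    because |f| < e/2 wherever psi is nonzero. *)
Lemma weierstrass_vanishing (R : realType) (K : set R) (f : R -> R)
    (v : {poly R}) (e : R) :
  compact K -> {within K, continuous f} -> 0 < e ->
  (forall x, K x -> 0 <= v.[x] <= 1) ->
  (forall x, K x -> v.[x] = 0 -> f x = 0) ->
  exists h : {poly R}, forall x, K x -> `|f x - v.[x] * h.[x]| <= e.
Proof.
move=> cK cf e0 v01 fv.
have e20 : 0 < e / 2 by rewrite divr_gt0.
pose psi x := Num.max (e / 2 - `|f x|) 0.
have psi0 x : 0 <= psi x by rewrite le_max lexx orbT.
have vpsi x : K x -> 0 < v.[x] + psi x.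
  move=> Kx; have /andP[v0 _] := v01 x Kx.
  have [v_gt0|v_le0] := ltP 0 v.[x]; first by rewrite ltr_wpDr.
  rewrite ltr_wpDl// lt_max; apply/orP; left.
  by rewrite fv// ?normr0 ?subr0//; apply/eqP; rewrite eq_le v_le0.
have [|h hP] :=
    @weierstrass R K (fun x => f x / (v.[x] + psi x)) (e / 2) cK _ e20.
  rewrite continuous_subspace_in => x /set_mem Kx.
  apply: cvgM; first exact: cf.
  apply: cvgV; first by rewrite gt_eqF// vpsi.
  apply: cvgD.
    by apply: continuous_subspaceT => y; exact: continuous_horner.
  apply: (@continuous_max R (subspace K) (fun y => e / 2 - `|f y|) (fun=> 0) x);
    last exact: cvg_cst.
  by apply: cvgB; [exact: cvg_cst|apply: cvg_norm; exact: cf].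
exists h => x Kx; have vp := vpsi x Kx; have /andP[v0 v1] := v01 x Kx.
have -> : f x - v.[x] * h.[x] = f x * (psi x / (v.[x] + psi x)) +
    v.[x] * (f x / (v.[x] + psi x) - h.[x]) by field; lra.
rewrite (splitr e) (le_trans (ler_normD _ _))// lerD//.
  rewrite normrM [X in _ * X]ger0_norm ?divr_ge0 ?(ltW vp)//.
  have [fe|fe] := leP (e / 2) `|f x|.
    have -> : psi x = 0 by rewrite /psi max_r// subr_le0.
    by rewrite mul0r mulr0 ltW.
  apply: le_trans (ltW fe); rewrite ler_piMr// ler_pdivrMr//; lra.
by rewrite normrM ger0_norm// (le_trans _ (hP x Kx))// ler_piMl.
Qed.

(** * The kernel of the integer polynomials of small norm *)

Lemma zpoly_fun0 (R : realType) (x : R) : zpoly_fun R 0 x = 0.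
Proof. by rewrite /zpoly_fun rmorph0 horner0. Qed.

Lemma zpoly_funD (R : realType) (P Q : {poly int}) (x : R) :
  zpoly_fun R (P + Q) x = zpoly_fun R P x + zpoly_fun R Q x.
Proof. by rewrite /zpoly_fun rmorphD hornerD. Qed.

Lemma zpoly_funB (R : realType) (P Q : {poly int}) (x : R) :
  zpoly_fun R (P - Q) x = zpoly_fun R P x - zpoly_fun R Q x.
Proof. by rewrite /zpoly_fun rmorphB hornerD hornerN. Qed.

Lemma zpoly_funM (R : realType) (P Q : {poly int}) (x : R) :
  zpoly_fun R (P * Q) x = zpoly_fun R P x * zpoly_fun R Q x.
Proof. by rewrite /zpoly_fun rmorphM hornerM. Qed.

Lemma zpoly_funX (R : realType) (P : {poly int}) (n : nat) (x : R) :
  zpoly_fun R (P ^+ n) x = zpoly_fun R P x ^+ n.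
Proof. by rewrite /zpoly_fun rmorphXn horner_exp. Qed.

Lemma poly_roots_exist (R : idomainType) (p : {poly R}) :
  p != 0 -> exists s : seq R, forall x, root p x -> x \in s.
Proof.
move: {2}(size p) (leqnn (size p)) => n; elim: n p => [|n IH] p.
  by rewrite leqn0 size_poly_eq0 => ->.
move=> sp p0; have [[a pa]|nr] := pselect (exists a, root p a); last first.
  by exists [::] => x px; case: nr; exists x.
have /factor_theorem[q pE] := pa.
have q0 : q != 0 by apply: contra_neq p0 => q0; rewrite pE q0 mul0r.
have [|//|s qs] := IH q.
  by move: sp; rewrite pE size_Mmonic ?monicXsubC// size_XsubC addn2.
exists (a :: s) => x; rewrite pE rootM root_XsubC inE orbC.
by case/orP => [->//|/qs ->]; rewrite orbT.
Qed.

Lemma Bset_le (R : realType) (K : set R) (P : {poly int}) :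
  compact K -> K !=set0 -> Bset K P ->
  exists2 r, 0 <= r < 1 & forall x, K x -> `|zpoly_fun R P x| <= r.
Proof.
move=> cK K0 PK; exists (supnorm K (zpoly_fun R P)) => [|x Kx].
  by rewrite supnorm_ge0//=; exact: PK.
exact: supnorm_ge.
Qed.

(** Even powers make the zeros of the sum the common zeros of P and Q; a large
    exponent keeps the norm of the sum below 1. *)
Lemma Bset_sum_even_powers (R : realType) (K : set R) (P Q : {poly int}) :
  compact K -> K !=set0 -> Bset K P -> Bset K Q ->
  exists n, Bset K (P ^+ n.+1.*2 + Q ^+ n.+1.*2).
Proof.
move=> cK K0 /(Bset_le cK K0)[r /andP[r0 r1] Pr] /(Bset_le cK K0)[s /andP[s0 s1] Qs].
have small (t : R) : 0 <= t -> t < 1 -> \forall n \near \oo, t ^+ n < 1 / 3.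
  move=> t0 t1; have /cvgrPdist_lt /(_ (1 / 3)) : (GRing.exp t : R^nat) @ \oo --> 0.
    by apply: cvg_expr; rewrite ger0_norm.
  have h : 0 < 1 / 3 :> R by lra.
  move=> /(_ h); apply: filterS => n.
  by rewrite sub0r normrN ger0_norm ?exprn_ge0.
have [n [rn sn]] := filter_ex (filterI (small r r0 r1) (small s s0 s1)).
exists n.
have bound (t : R) (T : {poly int}) x : 0 <= t -> t < 1 -> t ^+ n < 1 / 3 ->
    `|zpoly_fun R T x| <= t -> `|zpoly_fun R (T ^+ n.+1.*2) x| <= 1 / 3.
  move=> t0 t1 tn Tt; rewrite zpoly_funX normrX.
  apply: le_trans (ltW tn); apply: (@le_trans _ _ (t ^+ n.+1.*2)).
    by rewrite lerXn2r ?nnegrE.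
  by apply: ler_wiXn2l; rewrite ?(ltW t1)// -addnn (leq_trans (leqnSn n))// leq_addr.
apply: (@le_lt_trans _ _ (1 / 3 + 1 / 3)); last lra.
apply: supnorm_le => // x Kx.
rewrite zpoly_funD (le_trans (ler_normD _ _))// lerD//.
  exact: (bound r) (Pr x Kx).
exact: (bound s) (Qs x Kx).
Qed.

(** Starting from U = P, a zero y of P in K outside J(K) is removed by adding an even
    power of some Q in B(K) with Q(y) <> 0 to an even power of U. There are
    finitely many zeros to treat. *)
Lemma Jset_zero_locus (R : realType) (K : set R) (P : {poly int}) :
  compact K -> K !=set0 -> Bset K P -> P != 0 ->
  exists2 U, Bset K U & forall x, K x -> zpoly_fun R U x = 0 -> Jset K x.
Proof.
move=> cK K0 PB P0.
have [s sP] : exists s : seq R, forall x, zpoly_fun R P x = 0 -> x \in s.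
  have [|s sP] := @poly_roots_exist R (map_poly intr P).
    by rewrite map_poly_eq0_id0 ?intr_eq0// lead_coef_eq0.
  by exists s => x /eqP; exact: sP.
suff [U UB [UP Us]] : exists2 U, Bset K U &
    (forall x, K x -> zpoly_fun R U x = 0 -> zpoly_fun R P x = 0) /\
    (forall x, K x -> x \in s -> zpoly_fun R U x = 0 -> Jset K x).
  by exists U => // x Kx Ux; apply: Us => //; apply: sP; exact: UP.
elim: s {sP} => [|y s [U UB [UP Us]]]; first by exists P.
have [[Ky [Q QB Qy]]|nQ] :=
    pselect (K y /\ exists2 Q, Bset K Q & zpoly_fun R Q y != 0); last first.
  exists U => //; split=> // x Kx; rewrite inE => /predU1P[xy|]; last exact: Us.
  move=> _; split=> // Q QB; apply/eqP; apply: contra_notT nQ => Qx.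
  by rewrite -xy; split=> //; exists Q.
have [n UQB] := Bset_sum_even_powers cK K0 UB QB.
have zero x : zpoly_fun R (U ^+ n.+1.*2 + Q ^+ n.+1.*2) x = 0 ->
    zpoly_fun R U x = 0 /\ zpoly_fun R Q x = 0.
  move/eqP; rewrite zpoly_funD !zpoly_funX -muln2 !exprM paddr_eq0 ?sqr_ge0//.
  by rewrite !expf_eq0/= => /andP[/eqP ? /eqP ?].
exists (U ^+ n.+1.*2 + Q ^+ n.+1.*2) => //; split=> x Kx.
  by move=> /zero[Ux _]; exact: UP.
rewrite inE => /predU1P[->|xs] /zero[Ux Qx]; last exact: Us.
by rewrite Qx eqxx in Qy.
Qed.

(** * Uniform approximation *)

Lemma ZT_approximableP (R : realType) (K : set R) (f : R -> R) :
  ZT_approximable K f <-> forall e, 0 < e ->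
    exists P, forall x, K x -> `|f x - zpoly_fun R P x| < e.
Proof.
split=> [[P Pf] e e0|fP].
  have /Pf nearP : nbhs (f : {uniform` K -> R})
      [set g | forall x, K x -> `|f x - g x| < e].
    apply/uniform_nbhs; exists [set xy | ball xy.1 e xy.2]; split=> //.
    exact: (entourage_ball _ (PosNum e0)).
  have [n nP] := filter_ex (nearP : \forall n \near \oo,
    forall x, K x -> `|f x - zpoly_fun R (P n) x| < e).
  by exists (P n).
have inv0 n : 0 < n.+1%:R^-1 :> R by rewrite invr_gt0.
have [P PP] := choice (fun n => fP _ (inv0 n)).
exists P => A /uniform_nbhs[E [entE EA]].
have [e /= e0 eE] : exists2 e : R, 0 < e & forall x y, ball x e y -> E (x, y).
  move: entE; rewrite -entourage_ballE => -[e /= e0 eE].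
  by exists e => // x y xy; exact: (eE (x, y)).
near=> n; apply: EA => x Kx; apply: eE.
apply: (lt_trans (PP n x Kx)).
by near: n; exact: near_infty_natSinv_lt (PosNum e0).
Unshelve. all: by end_near. Qed.

Theorem mainTheorem8 (R : realType) (K : set R) (f : R -> R)
    (cK : compact K) (infK : infinite_set K) (capK : cap K < 1)
    (fcont : {within K, continuous f}) :
  ZT_approximable K f <-> ZT_interpolable (Jset K) f.
Proof.
have K0 := infinite_set_nonempty infK.
split=> [/ZT_approximableP fP|[S fS]].
  have [P PP] := fP (1 / 3) ltac:(lra).
  exists P => x [Kx xJ]; apply/eqP; rewrite -subr_eq0 -normr_le0.
  apply/ler_addgt0Pl => e e0; rewrite addr0.
  (* Within 1/3 of f, so that Q - P lies in B(K); within e, to conclude. *)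
  pose d := Num.min e (1 / 3).
  have [Q QQ] := fP d ltac:(by rewrite lt_min e0; lra).
  have QPx : zpoly_fun R (Q - P) x = 0.
    apply: xJ; apply: (@le_lt_trans _ _ (1 / 3 + 1 / 3)); last lra.
    apply: supnorm_le => // y Ky; rewrite zpoly_funB.
    rewrite (le_trans (ler_distD (f y) _ _))// lerD// ?(ltW (PP _ _))//.
    by rewrite distrC (le_trans (ltW (QQ _ _)))// ge_min lexx orbT.
  move/eqP: QPx; rewrite zpoly_funB subr_eq0 => /eqP <-.
  by rewrite (le_trans (ltW (QQ _ _)))// ge_min lexx.
apply/ZT_approximableP => e e0.
have [[P PB P0]|noP] := pselect (exists2 P, Bset K P & P != 0); last first.
  exists S => x Kx; rewrite fS ?subrr ?normr0//; split=> // P PB.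
  have [->|P0] := eqVneq P 0; first exact: zpoly_fun0.
  by case: noP; exists P.
have [U UB UJ] := Jset_zero_locus cK K0 PB P0.
have [q [mq sq q1]] := cap_lt1_monic cK infK capK.
have [C roundC] := rounding cK mq sq q1.
have [r /andP[r0 r1] Ur] := Bset_le cK K0 UB.
have [n rn] : exists n, r ^+ n * C < e / 2.
  have : (fun n => r ^+ n * C) @ \oo --> 0 * C.
    apply: cvgM; last exact: cvg_cst.
    by apply: cvg_expr; rewrite ger0_norm.
  rewrite mul0r => /cvgrPdist_lt /(_ (e / 2)); rewrite divr_gt0// => /(_ isT).
  move=> /filter_ex[n nP]; exists n.
  by apply: le_lt_trans nP; rewrite sub0r normrN ler_norm.
(* The exponent is even, so that V >= 0 on K, and positive, so that V vanishes
   with U. *)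
pose V := U ^+ n.+1.*2.
have VE x : zpoly_fun R V x = (zpoly_fun R U x ^+ n.+1) ^+ 2.
  by rewrite zpoly_funX -muln2 exprM.
have Vr x : K x -> `|zpoly_fun R V x| <= r ^+ n.+1.*2.
  by move=> Kx; rewrite zpoly_funX normrX lerXn2r ?nnegrE ?Ur.
have [||||h hP] := @weierstrass_vanishing R K (fun x => f x - zpoly_fun R S x)
    (map_poly intr V) (e / 2) cK.
- move=> x; apply: cvgB; first exact: fcont.
  by apply: continuous_subspaceT => y; exact: continuous_horner.
- by rewrite divr_gt0.
- move=> x Kx; rewrite -/(zpoly_fun R V x); apply/andP; split.
    by rewrite VE sqr_ge0.
  by rewrite (le_trans (ler_norm _))// (le_trans (Vr x Kx))// exprn_ile1// ltW.
- move=> x Kx; rewrite -/(zpoly_fun R V x) VE => /eqP.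
  by rewrite !expf_eq0/= => /eqP /(UJ x Kx) /fS ->; rewrite subrr.
have [z hz] := roundC h.
exists (S + V * z) => x Kx; rewrite zpoly_funD zpoly_funM.
have -> : f x - (zpoly_fun R S x + zpoly_fun R V x * zpoly_fun R z x) =
   (f x - zpoly_fun R S x - zpoly_fun R V x * h.[x]) +
   zpoly_fun R V x * (h.[x] - zpoly_fun R z x) by ring.
rewrite (splitr e) (le_lt_trans (ler_normD _ _))// ler_ltD//; first exact: hP.
apply: le_lt_trans rn; rewrite normrM ler_pM ?hz// (le_trans (Vr x Kx))//.
by apply: ler_wiXn2l; rewrite ?(ltW r1)// -addnn (leq_trans (leqnSn n))// leq_addr.
Qed.
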